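(* Let $A=(a_{ij})\in\mathbb{C}^{M\times n}$ with $M\ge n$, let $s=(s_1,\dots,s_n)$ be integers with $1\le s_1<s_2<\dots<s_n\le M$, and define $\lambda=(\lambda_1,\dots,\lambda_n)$ by $\lambda_i:=s_{n-i+1}-(n-i+1)$. Let $A_{(s,:)}$ denote the $n\times n$ submatrix of $A$ formed by the rows $s_1,\dots,s_n$. Then $$|A_{(s,:)}|=\sum_{\mu\in\mathcal{D}_\lambda}K_{\lambda,\mu}\,D_\mu,\qquad D_\mu:=\sum_{p\in\mathcal{P}(\mu)}\begin{vmatrix}a_{p_1+1,1}&\cdots&a_{p_n+1,n}\\ \vdots&&\vdots\\ a_{p_1+n,1}&\cdots&a_{p_n+n,n}\end{vmatrix},$$ i.e. the $(i,j)$ entry of the determinant in $D_\mu$ is $a_{p_j+i,\,j}$.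
   Context: $|X|$ denotes the determinant. $\lambda$ is a weakly decreasing $n$-tuple of nonnegative integers (a partition). $\mathcal{D}_\lambda$ denotes the set of weakly decreasing $n$-tuples $\mu=(\mu_1\ge\dots\ge\mu_n)$ of nonnegative integers with $\sum_i\mu_i=\sum_i\lambda_i$. For a tuple $\mu$, $\mathcal{P}(\mu)$ denotes the set of all distinct rearrangements (permutations of the entries) of $\mu$. $K_{\lambda,\mu}$ is the Kostka number: the number of semistandard Young tableaux of shape $\lambda$ (Young diagram with $\lambda_j$ left-aligned boxes in row $j$) and weight $\mu$, i.e. fillings of the boxes with integers in which the $i$-th smallest value $i$ appears exactly $\mu_i$ times, entries weakly increase along rows (left to right) and strictly increase down columns. Terms with $K_{\lambda,\mu}=0$ contribute zero (for $\mu$ with $K_{\lambda,\mu}>0$ all row indices $p_j+i$ lie in $(1:M)$). *)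

(* Defs.v *)
From mathcomp Require Import all_boot all_order all_algebra.
From mathcomp Require Import perm reals complex.

Set Implicit Arguments.
Unset Strict Implicit.
Unset Printing Implicit Defensive.

Import GRing.Theory.
Local Open Scope ring_scope.

(* All indices are 0-based: [i : 'I_n] stands for the index i + 1, and
   [s : 'I_n -> 'I_M] for the 1-based rows s_(i+1) = s i + 1.  Hence
   s_(n-i+1) - (n-i+1) becomes [s (rev_ord i) - rev_ord i]; the truncated
   subtraction is exact when s is strictly increasing. *)
Definition shape_of (M n : nat) (s : 'I_n -> 'I_M) : 'I_n -> nat :=
  fun i => (s (rev_ord i) - rev_ord i)%N.

Definition weakly_decreasing (n : nat) (mu : 'I_n -> nat) : bool :=
  [forall i : 'I_n, forall j : 'I_n, (i <= j)%N ==> (mu j <= mu i)%N].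

Definition weight (n : nat) (mu : 'I_n -> nat) : nat := (\sum_(i < n) mu i)%N.

(* An entry of a tuple of weight N is at most N, so bounding the entries by N
   loses nothing and makes the index set finite. *)
Definition decreasing_tuples (n : nat) (lam : 'I_n -> nat) :
    {set {ffun 'I_n -> 'I_(weight lam).+1}} :=
  [set mu : {ffun 'I_n -> 'I_(weight lam).+1} |
    weakly_decreasing (fun i => mu i) &&
    (weight (fun i => mu i) == weight lam)].

Definition rearrangements (n k : nat) (mu : {ffun 'I_n -> 'I_k}) :
    {set {ffun 'I_n -> 'I_k}} :=
  [set [ffun i => mu (sigma i)] | sigma : 'S_n].

(* A box is a dependent pair (row j, column c) with c < lam j. *)
Definition box (n : nat) (lam : 'I_n -> nat) : finType :=
  {j : 'I_n & 'I_(lam j)}.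

Definition box_row (n : nat) (lam : 'I_n -> nat) (b : box lam) : nat := tag b.

Definition box_col (n : nat) (lam : 'I_n -> nat) (b : box lam) : nat :=
  tagged b.

(* A weight mu with n parts and total the number of boxes leaves no room for
   values other than 1, ..., n. *)
Definition filling (n : nat) (lam : 'I_n -> nat) : finType :=
  {ffun box lam -> 'I_n}.

Definition semistandard (n : nat) (lam : 'I_n -> nat) (T : filling lam) : bool :=
  [forall b : box lam, forall b' : box lam,
     ((box_row b == box_row b') && (box_col b < box_col b')%N
        ==> (T b <= T b')%N) &&
     ((box_col b == box_col b') && (box_row b < box_row b')%N
        ==> (T b < T b')%N)].

Definition has_weight (n : nat) (lam mu : 'I_n -> nat) (T : filling lam) : bool :=
  [forall i : 'I_n, #|[set b : box lam | T b == i]| == mu i].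

Definition Kostka (n : nat) (lam mu : 'I_n -> nat) : nat :=
  #|[set T : filling lam | semistandard T && has_weight mu T]|.

(* The entry in (0-based) row r and column j, read as 0 when r is not a row of
   A; such entries only occur in terms whose Kostka number vanishes. *)
Definition entry (R : pzRingType) (M n : nat) (A : 'M[R]_(M, n)) (r : nat)
    (j : 'I_n) : R :=
  if insub r is Some i then A i j else 0.

Definition Dsum (R : comPzRingType) (M n k : nat) (A : 'M[R]_(M, n))
    (mu : {ffun 'I_n -> 'I_k}) : R :=
  \sum_(p in rearrangements mu)
    \det (\matrix_(i < n, j < n) entry A (p j + i)%N j).

(* Main.v *)
Require Import Defs.
From mathcomp Require Import all_boot all_order all_algebra.
From mathcomp Require Import perm reals complex.
From mathcomp Require Import mpoly.
From mathcomp Require Import zify ring.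

(* Applying the linear map [x_1^(r_1) ... x_n^(r_n) |-> \prod_j a_(r_j, j)] to
   the bialternant identity [schur lam * det (x_j^i) = det (x_j^(s_i))] turns it
   into [det (a_(s_i, j)) = \sum_T det (a_(c_j(T) + i, j))], where T runs over
   the semistandard tableaux of shape lam and c(T) is the content of T.  Grouping
   the T by content gives Kostka numbers, which are invariant under permutation
   of the weight.

   The bialternant identity is proved by induction on n: row operations split
   off the factor [\prod_j (x_n - x_j)] and leave a sum over the sequences t
   with [s_i <= t_i < s_(i+1)], while deleting the letter n from a tableau gives
   the same recursion for [schur]. *)

Set Implicit Arguments.
Unset Strict Implicit.
Unset Printing Implicit Defensive.

Import GRing.Theory.
Local Open Scope ring_scope.

(** * Alternants and their branching rule *)

Definition alternant (R : comPzRingType) (n : nat) (s : 'I_n -> nat)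
    (x : nat -> R) : R :=
  \det (\matrix_(i < n, j < n) x j ^+ s i).

Definition interlaced (n B : nat) (s : 'I_n.+1 -> nat)
    (t : {ffun 'I_n -> 'I_B}) : bool :=
  [forall i : 'I_n,
    (s (widen_ord (leqnSn n) i) <= t i < s (lift ord0 i))%N].

(** Multilinearity in the rows: each product of sums in the Leibniz formula expands over choice
    functions [f], after which the two summations are exchanged. *)
Lemma det_rows_sum (R : comPzRingType) (n : nat) (K : finType)
    (G : 'I_n -> K -> R) (H : K -> 'I_n -> R) :
  \det (\matrix_(i < n, j < n) \sum_(k : K) G i k * H k j) =
  \sum_(f : {ffun 'I_n -> K})
    (\prod_(i < n) G i (f i)) * \det (\matrix_(i < n, j < n) H (f i) j).
Proof.
rewrite /determinant.
transitivity (\sum_(sg : 'S_n) \sum_(f : {ffun 'I_n -> K})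
   (-1) ^+ sg * \prod_i (G i (f i) * H (f i) (sg i))).
  apply: eq_bigr => sg _; rewrite -mulr_sumr; congr (_ * _).
  rewrite -(bigA_distr_bigA (fun i k => G i k * H k (sg i))) /=.
  by apply: eq_bigr => i _; rewrite mxE.
rewrite exchange_big /=; apply: eq_bigr => f _.
rewrite mulr_sumr; apply: eq_bigr => sg _.
rewrite big_split /= mulrCA; congr (_ * (_ * _)).
by apply: eq_bigr => i _; rewrite mxE.
Qed.

(** A geometric sum for [x ^+ (b - a) - y ^+ (b - a)], shifted by [x ^+ a]. It is padded with zeros
    to ['I_B] because [det_rows_sum] needs one index type common to all rows. *)
Lemma sub_exp_interval (R : comPzRingType) (x y : R) (a b B : nat) :
  (a <= b)%N -> (b <= B)%N ->
  x ^+ b - y ^+ (b - a) * x ^+ a =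
  (x - y) * \sum_(t < B) (if (a <= t < b)%N then y ^+ (b - t.+1) else 0)
                          * x ^+ t.
Proof.
move=> leab lebB.
have -> : x ^+ b - y ^+ (b - a) * x ^+ a = (x ^+ (b - a) - y ^+ (b - a)) * x ^+ a.
  by rewrite mulrBl -exprD subnK.
rewrite -opprB subrXX -mulNr opprB -mulrA; congr (_ * _).
rewrite (bigID (fun t : 'I_B => (a <= t < b)%N)) /= [X in _ = _ + X]big1 ?addr0; last first.
  by move=> i /negbTE ->; rewrite mul0r.
rewrite (eq_bigr (fun t : 'I_B => y ^+ (b - t.+1) * x ^+ t)); last by move=> i ->.
rewrite -(big_mkord (fun t => a <= t < b)%N (fun t => y ^+ (b - t.+1) * x ^+ t)).
rewrite mulr_suml -(big_mkord xpredT (fun i => y ^+ ((b - a).-1 - i) * x ^+ i * x ^+ a)).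
rewrite [RHS](big_cat_nat (n := a)) ?(leq_trans leab) //= [X in _ = X + _]big_nat_cond [X in _ = X + _]big1 ?add0r; last first.
  by move=> i /andP[/andP[_ h]] /andP[h2 _]; lia.
rewrite [RHS](big_cat_nat (n := b)) //= [X in _ = _ + X]big_nat_cond [X in _ = _ + X]big1 ?addr0; last first.
  by move=> i /andP[/andP[h _]] /andP[_ h2]; lia.
rewrite [RHS]big_nat_cond.
rewrite [RHS](eq_bigl (fun i => (a <= i < b)%N && true)) => [|i]; last first.
  by rewrite andbb andbT.
rewrite -[RHS]big_nat_cond -(add0n a) big_addn !add0n.
apply: eq_bigr => i _; rewrite -mulrA -exprD.
by congr (_ ^+ _ * _); lia.
Qed.

(* Subtracting [y ^+ (s_(i+1) - s_i)] times row [i] from row [i+1], where [y]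
   is the last variable, clears the last column below its top entry and makes
   column [j] divisible by [x j - y]. *)
Lemma alternant_branching (R : comPzRingType) (n B : nat) (s : 'I_n.+1 -> nat)
    (x : nat -> R) :
  (forall i j : 'I_n.+1, (i < j)%N -> (s i < s j)%N) ->
  (forall i, (s i <= B)%N) ->
  alternant s x =
  (\prod_(j < n) (x n - x j)) *
  \sum_(t : {ffun 'I_n -> 'I_B} | interlaced s t)
     (x n ^+ s ord0 * \prod_(i < n) x n ^+ (s (lift ord0 i) - (t i).+1))
     * alternant (fun i => t i) x.
Proof.
move=> hs hB; set y := x n.
pose L := \matrix_(i < n.+1, k < n.+1)
  ((i == k)%:R - (if (k.+1 == i)%N then y ^+ (s i - s k) else 0) : R).
have detL : \det L = 1.
  rewrite det_trig; last first.
    apply/is_trig_mxP => i j ltij; rewrite mxE.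
    have -> : (i == j) = false by apply/eqP => e; rewrite e ltnn in ltij.
    by case: eqP => [e|]; [lia | rewrite subr0].
  apply: big1 => i _; rewrite mxE eqxx; case: eqP => [e|]; [lia | by rewrite subr0].
pose X := \matrix_(i < n.+1, j < n.+1) x j ^+ s i.
have LX0 j : (L *m X) ord0 j = x j ^+ s ord0.
  rewrite mxE (bigD1 ord0) //= big1 ?addr0; last first.
    move=> k nk; rewrite !mxE eq_sym (negbTE nk) /= subr0 mul0r //.
  by rewrite !mxE eqxx /= subr0 mul1r.
have LXS (i : 'I_n) j : (L *m X) (lift ord0 i) j =
    x j ^+ s (lift ord0 i)
    - y ^+ (s (lift ord0 i) - s (widen_ord (leqnSn n) i))
      * x j ^+ s (widen_ord (leqnSn n) i).
  rewrite mxE (bigD1 (lift ord0 i)) //= (bigD1 (widen_ord (leqnSn n) i)) /=; last first.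
    by apply/eqP => /(congr1 val) /=; rewrite /bump; lia.
  rewrite big1 ?addr0 => [|k /andP[nk1 nk2]].
    rewrite !mxE eqxx.
    have -> : ((lift ord0 i).+1 == lift ord0 i :> nat) = false by lia.
    have -> : (lift ord0 i == widen_ord (leqnSn n) i) = false.
      by apply/eqP => /(congr1 val) /=; rewrite /bump; lia.
    have -> : ((widen_ord (leqnSn n) i).+1 == lift ord0 i :> nat) by rewrite /= /bump; lia.
    by rewrite /= subr0 mul1r sub0r mulNr.
  rewrite !mxE eq_sym (negbTE nk1).
  have -> : (k.+1 == lift ord0 i :> nat) = false.
    apply/eqP => /= e; move/eqP: nk2; apply; apply: val_inj => /=; move: e; rewrite /bump; lia.
  by rewrite subr0 mul0r.
have lt_s (i : 'I_n) : (s (widen_ord (leqnSn n) i) < s (lift ord0 i))%N.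
  by apply: hs; rewrite /= /bump; lia.
have -> : alternant s x = \det (L *m X) by rewrite det_mulmx detL mul1r.
(* In the last column [x j] is [y] itself, so every entry below the top one cancels. *)
rewrite (expand_det_col _ ord_max) (bigD1 ord0) //= big1 ?addr0; last first.
  move=> i; case: (unliftP ord0 i) => [k ->|->]; last by rewrite eqxx.
  by move=> _; rewrite LXS -exprD subnK ?subrr ?mul0r // ltnW.
rewrite LX0 /cofactor /= add0n.
set N := row' _ _.
have -> : N = (\matrix_(i < n, j < n) \sum_(t < B)
     (if (s (widen_ord (leqnSn n) i) <= t < s (lift ord0 i))%N
       then y ^+ (s (lift ord0 i) - t.+1) else 0) * x j ^+ t)
     *m diag_mx (\row_j (x j - y)).
  apply/matrixP => i j; rewrite mul_mx_diag !mxE.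
  have := LXS i (lift ord_max j); rewrite mxE => ->.
  by rewrite lift_max (sub_exp_interval _ _ _ (hB _)) ?(ltnW (lt_s i)) // mulrC.
rewrite det_mulmx det_diag.
rewrite (det_rows_sum (fun i (t : 'I_B) => if (s (widen_ord (leqnSn n) i) <= t < s (lift ord0 i))%N
       then y ^+ (s (lift ord0 i) - t.+1) else 0) (fun t j => x j ^+ t)).
(* The sign from turning each [x j - y] into [y - x j] will cancel the cofactor sign of the top
   right entry. *)
have -> : \prod_(i < n) (\row_(j < n) (x j - y)) ord0 i = (-1) ^+ n * \prod_(j < n) (y - x j).
  have -> : (-1) ^+ n = \prod_(j < n) (-1) :> R by rewrite prodr_const card_ord.
  rewrite -big_split /=.
  by apply: eq_bigr => i _; rewrite mxE mulN1r opprB.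
rewrite -/y.
set S1 := \sum_f _; set S2 := \sum_(t | _) _; set P := \prod_(_ < _) _.
(* A choice [t] that does not interlace has a zero factor, coming from the [else] branch. *)
have -> : S2 = y ^+ s ord0 * S1.
  rewrite /S1 mulr_sumr (bigID (interlaced s)) /= [X in _ = _ + X]big1 ?addr0; last first.
    move=> t /forallPn /= [i /negbTE hi].
    by rewrite (bigD1 i) //= hi !mul0r mulr0.
  apply: eq_bigr => t /forallP ht; rewrite -mulrA; congr (_ * (_ * _)).
  by apply: eq_bigr => i _; rewrite ht.
have e1 : (-1) ^+ n * (-1) ^+ n = 1 :> R by rewrite -exprMn mulrNN mulr1 expr1n.
rewrite (_ : y ^+ s ord0 * _ = ((-1) ^+ n * (-1) ^+ n) * (P * (y ^+ s ord0 * S1))).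
  by rewrite e1 mul1r.
ring.
Qed.

(** For consecutive exponents each interval [i <= t i < i + 1] is a single point, so only the
    identity interlaces. *)
Lemma alternant_id_branching (R : comPzRingType) (n : nat) (x : nat -> R) :
  alternant (fun i : 'I_n.+1 => i : nat) x =
  (\prod_(j < n) (x n - x j)) * alternant (fun i : 'I_n => i : nat) x.
Proof.
rewrite (@alternant_branching _ _ n) //; last by move=> i; rewrite -ltnS.
congr (_ * _); rewrite (big_pred1 [ffun i => i]) /=.
  rewrite expr0 mul1r big1 ?mul1r => [|i _]; last first.
    by rewrite ffunE /= /bump /= add1n subnn expr0.
  by congr (\det _); apply/matrixP => i j; rewrite !mxE ffunE.
move=> t; apply/forallP/eqP => [h|-> i]; last first.
  by rewrite ffunE /= /bump /=; lia.
apply/ffunP => i; apply: val_inj; rewrite ffunE /=.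
by move: (h i); rewrite /= /bump /=; lia.
Qed.

(** * Schur polynomials, and fillings read by row and column *)

(** Convertible to [shape_of] on row indices, but free of the bound [M], since the induction passes
    to sequences [t] with another range. *)
Definition shape_of_nat (n : nat) (s : 'I_n -> nat) : 'I_n -> nat :=
  fun i => (s (rev_ord i) - rev_ord i)%N.

(** The variables form a sequence indexed by [nat], so that the same [x] serves for [n] and [n.+1]
    letters, the new variable being [x n]. *)
Definition schur (R : comPzRingType) (n : nat) (lam : 'I_n -> nat)
    (x : nat -> R) : R :=
  \sum_(T : filling lam | semistandard T) \prod_(b : box lam) x (T b).

(* Boxes outside the shape get the value [n], larger than every letter: this
   is the value that [extend_filling] puts into the new boxes. *)
Definition box_value (n : nat) (lam : 'I_n -> nat) (T : filling lam)
    (j : 'I_n) (c : nat) : nat :=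
  if (insub c : option 'I_(lam j)) is Some c'
  then T (Tagged (fun j => 'I_(lam j)) c') else n.

(** Out-of-range values fall back to the row index [tag b], an inhabitant of ['I_n] available at
    every box. *)
Definition mk_filling (n : nat) (lam : 'I_n -> nat) (f : 'I_n -> nat -> nat) :
    filling lam :=
  [ffun b : box lam => insubd (tag b) (f (tag b) (tagged b))].

Section Fillings.
Variables (n : nat) (lam : 'I_n -> nat).
Implicit Types T : filling lam.

Lemma box_value_tagged T (b : box lam) :
  box_value T (tag b) (tagged b) = T b.
Proof.
by case: b => j c; rewrite /box_value /= valK.
Qed.

Lemma box_value_lt T j c : (c < lam j)%N -> (box_value T j c < n)%N.
Proof. by move=> h; rewrite /box_value insubT /=. Qed.

Lemma box_value_out T j c : (lam j <= c)%N -> box_value T j c = n.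
Proof. by move=> h; rewrite /box_value insubF // ltnNge h. Qed.

Lemma box_value_le T j c : (box_value T j c <= n)%N.
Proof.
case: (ltnP c (lam j)) => h; first by rewrite ltnW // box_value_lt.
by rewrite box_value_out.
Qed.

Lemma box_value_mk f j c :
  (c < lam j)%N -> (f j c < n)%N -> box_value (mk_filling lam f) j c = f j c.
Proof.
move=> hc hf; rewrite /box_value insubT /= ffunE /=.
by rewrite insubdK.
Qed.

Lemma filling_ext T T' :
  (forall j c, (c < lam j)%N -> box_value T j c = box_value T' j c) -> T = T'.
Proof.
move=> h; apply/ffunP => b; apply: val_inj => /=.
by rewrite -!box_value_tagged h.
Qed.

Lemma semistandardP T :
  reflect ((forall j c c', (c < c' < lam j)%N ->
              (box_value T j c <= box_value T j c')%N) /\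
           (forall (j j' : 'I_n) c, (j < j')%N -> (c < lam j)%N -> (c < lam j')%N ->
              (box_value T j c < box_value T j' c)%N))
          (semistandard T).
Proof.
apply: (iffP idP) => [ss|[hr hc]].
  split=> [j c c' /andP[h1 h2]|j j' c hj h1 h2].
    pose b := Tagged (fun j => 'I_(lam j)) (Ordinal (ltn_trans h1 h2)).
    pose b' := Tagged (fun j => 'I_(lam j)) (Ordinal h2).
    move/forallP: ss => /(_ b) /forallP /(_ b') /andP[/implyP h _].
    rewrite -(box_value_tagged T b) -(box_value_tagged T b') in h.
    by apply: h; rewrite /box_row /box_col /= eqxx.
  pose b := Tagged (fun j => 'I_(lam j)) (Ordinal h1).
  pose b' := Tagged (fun j => 'I_(lam j)) (Ordinal h2).
  move/forallP: ss => /(_ b) /forallP /(_ b') /andP[_ /implyP h].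
  rewrite -(box_value_tagged T b) -(box_value_tagged T b') in h.
  by apply: h; rewrite /box_row /box_col /= eqxx.
apply/forallP => b; apply/forallP => b'.
rewrite -(box_value_tagged T b) -(box_value_tagged T b').
case: b b' => [j c] [j' c']; rewrite /box_row /box_col /=.
apply/andP; split; apply/implyP => /andP[/eqP e lt].
  have ej : j = j' by apply: val_inj.
  by subst j'; apply: hr; rewrite lt /=.
by rewrite -e; apply: hc => //; rewrite e.
Qed.

Lemma prod_boxes (R : comPzRingType) (x : nat -> R) T :
  \prod_(b : box lam) x (T b) =
  \prod_(j < n) \prod_(0 <= c < lam j) x (box_value T j c).
Proof.
under [RHS]eq_bigr => j _ do rewrite big_mkord.
rewrite (@sig_big_dep _ _ _ _ (fun j : 'I_n => 'I_(lam j)) xpredT (fun _ => xpredT)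
  (fun j c => x (box_value T j c))) /=.
by apply: eq_bigr => b _; rewrite box_value_tagged.
Qed.

(** Induction down a column: the shape decreases, so every box has one directly above it, and each
    step down raises the entry by at least one. *)
Lemma row_le_box_value T j c :
  (forall i i' : 'I_n, (i <= i')%N -> (lam i' <= lam i)%N) ->
  semistandard T -> (c < lam j)%N -> (j <= box_value T j c)%N.
Proof.
move=> anti /semistandardP[_ hc].
case: j => j ltjn; elim: j ltjn => [//|j IH] ltjn h.
have h' : (c < lam (Ordinal (ltnW ltjn)))%N.
  by apply: leq_trans h _; apply: anti => /=.
by apply: leq_ltn_trans (IH _ h') _; apply: hc.
Qed.

End Fillings.

(** * Deleting the largest letter from a tableau *)

Section Branching.
Variables (n : nat) (lam : 'I_n.+1 -> nat) (nu : 'I_n -> nat).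

(** On these rows, [nu] is the shape formed by the letters below [n]. The last row is left out: in a
    tableau of decreasing shape it contains only the letter [n]. *)
Definition splits_at (T : filling lam) : bool :=
  [forall j : 'I_n, forall c : 'I_(lam (lift ord_max j)),
     (box_value T (lift ord_max j) c < n)%N == (c < nu j)%N].

Lemma splits_atP (T : filling lam) :
  reflect (forall j c, (c < lam (lift ord_max j))%N ->
             (box_value T (lift ord_max j) c < n)%N = (c < nu j)%N)
          (splits_at T).
Proof.
apply: (iffP forallP) => [h j c hc|h j].
  by move/forallP: (h j) => /(_ (Ordinal hc)) /eqP.
by apply/forallP => c; apply/eqP; apply: h.
Qed.

Definition extend_filling (T : filling nu) : filling lam :=
  mk_filling lam
    (fun j c => if unlift ord_max j is Some j' then box_value T j' c else n).

Definition restrict_filling (T : filling lam) : filling nu :=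
  mk_filling nu (fun j c => box_value T (lift ord_max j) c).

Lemma box_value_extend (T : filling nu) (j : 'I_n) c :
  (c < lam (lift ord_max j))%N ->
  box_value (extend_filling T) (lift ord_max j) c = box_value T j c.
Proof.
move=> h; rewrite box_value_mk // liftK //.
by rewrite ltnS box_value_le.
Qed.

Lemma box_value_extend_max (T : filling nu) c :
  (c < lam ord_max)%N -> box_value (extend_filling T) ord_max c = n.
Proof. by move=> h; rewrite box_value_mk // unlift_none. Qed.

Hypothesis lam_anti : forall i i' : 'I_n.+1, (i <= i')%N -> (lam i' <= lam i)%N.
Hypothesis strip :
  forall j : 'I_n, (lam (lift ord0 j) <= nu j <= lam (lift ord_max j))%N.

Let nu_le j : (nu j <= lam (lift ord_max j))%N.
Proof. by case/andP: (strip j). Qed.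

Let lam_le_nu (j : 'I_n) (i : 'I_n.+1) : (j < i)%N -> (lam i <= nu j)%N.
Proof.
move=> lt; case/andP: (strip j) => h _; apply: leq_trans h.
by apply: lam_anti; rewrite /= /bump; lia.
Qed.

Lemma splits_at_extend (T : filling nu) : splits_at (extend_filling T).
Proof.
apply/splits_atP => j c hc; rewrite box_value_extend //.
case: (ltnP c (nu j)) => h; first by rewrite box_value_lt.
by rewrite box_value_out // ltnn.
Qed.

(** The hypothesis [strip] makes [lam / nu] a horizontal strip: any box of [lam] above another one
    lies in [nu]. Hence a new letter [n] never sits above another box, and columns stay strict. *)
Lemma semistandard_extend (T : filling nu) :
  semistandard (extend_filling T) = semistandard T.
Proof.
apply/semistandardP/semistandardP => [[hr hc]|[hr hc]]; split.
- move=> j c c' /andP[h1 h2].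
  have h3 := leq_trans h2 (nu_le j).
  have := hr (lift ord_max j) c c'; rewrite h1 h3 => /(_ isT).
  by rewrite !box_value_extend // (ltn_trans h1).
- move=> j j' c hj h1 h2.
  have h3 := leq_trans h1 (nu_le j); have h4 := leq_trans h2 (nu_le j').
  have := hc (lift ord_max j) (lift ord_max j') c.
  by rewrite !lift_max !box_value_extend //; apply.
- move=> j c c' /andP[h1 h2].
  case: (unliftP ord_max j) h2 => [j' ->|->] h2; last first.
    by rewrite !box_value_extend_max // (ltn_trans h1).
  rewrite !box_value_extend // ?(ltn_trans h1) //.
  case: (ltnP c' (nu j')) => h; first by apply: hr; rewrite h1.
  by rewrite (box_value_out _ h) box_value_le.
move=> j j' c; case: (unliftP ord_max j) => [i ->|->]; last by move=> /=; have := ltn_ord j'; lia.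
case: (unliftP ord_max j') => [i' ->|->] hij h1 h2; last first.
  rewrite box_value_extend_max // box_value_extend // box_value_lt //.
  by apply: leq_trans h2 _; apply: lam_le_nu; exact: ltn_ord.
rewrite !box_value_extend //; rewrite !lift_max in hij.
have h3 : (c < nu i)%N.
  by apply: leq_trans h2 _; apply: lam_le_nu; rewrite lift_max.
case: (ltnP c (nu i')) => h; first exact: hc.
by rewrite (box_value_out _ h) box_value_lt.
Qed.

Lemma restrict_extend (T : filling nu) : restrict_filling (extend_filling T) = T.
Proof.
apply: filling_ext => j c hc; have h := leq_trans hc (nu_le j).
by rewrite box_value_mk // box_value_extend // box_value_lt.
Qed.

Lemma extend_restrict (T : filling lam) :
  semistandard T -> splits_at T -> extend_filling (restrict_filling T) = T.
Proof.
move=> ss /splits_atP sp; apply: filling_ext => j c.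
case: (unliftP ord_max j) => [i ->|->] hc; last first.
  (* Entries of row [n] are at least [n] by column strictness, and at most [n] by the range of
     letters. *)
  rewrite box_value_extend_max //; apply/eqP; rewrite eqn_leq.
  by rewrite (row_le_box_value lam_anti ss hc) -ltnS box_value_lt.
rewrite box_value_extend //; case: (ltnP c (nu i)) => h.
  by rewrite box_value_mk // sp.
rewrite box_value_out //; apply/eqP; rewrite eqn_leq -(ltnS _ n) box_value_lt // andbT.
by rewrite leqNgt sp // -leqNgt.
Qed.

(** The exponents of [x n] count, row by row, the boxes outside [nu]. *)
Lemma prod_extend (R : comPzRingType) (x : nat -> R) (T : filling nu) :
  \prod_(b : box lam) x (extend_filling T b) =
  (x n ^+ lam ord_max * \prod_(j < n) x n ^+ (lam (lift ord_max j) - nu j))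
  * \prod_(b : box nu) x (T b).
Proof.
rewrite !prod_boxes big_ord_recr /= mulrC -mulrA; congr (_ * _).
  rewrite -[in RHS](subn0 (lam _)) -prodr_const_nat; apply: eq_big_nat => c /andP[_ h].
  by rewrite box_value_extend_max.
rewrite -big_split /=; apply: eq_bigr => j _.
have -> : widen_ord (leqnSn n) j = lift ord_max j.
  by apply: val_inj; rewrite -[RHS]/(nat_of_ord _) lift_max.
rewrite (big_cat_nat (n := nu j)) //= mulrC; congr (_ * _).
  rewrite -prodr_const_nat; apply: eq_big_nat => c /andP[h1 h2].
  by rewrite box_value_extend // box_value_out.
apply: eq_big_nat => c /andP[_ h].
by rewrite box_value_extend // (leq_trans h).
Qed.

(** Extension and restriction are inverse bijections between the tableaux of shape [nu] and those of
    shape [lam] that split at [nu]. *)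
Lemma schur_fiber (R : comPzRingType) (x : nat -> R) :
  \sum_(T : filling lam | semistandard T && splits_at T)
     \prod_(b : box lam) x (T b) =
  (x n ^+ lam ord_max * \prod_(j < n) x n ^+ (lam (lift ord_max j) - nu j))
  * schur nu x.
Proof.
rewrite (reindex_onto extend_filling restrict_filling) /=; last first.
  by move=> T /andP[]; apply: extend_restrict.
rewrite mulr_sumr; apply: eq_big => [T|T _]; last exact: prod_extend.
by rewrite semistandard_extend splits_at_extend restrict_extend eqxx !andbT.
Qed.

End Branching.

(** * Monotone sequences and interlacing *)

(** Applied to a weakly increasing row, this yields the length of the initial segment of letters
    below [n]. *)
Lemma antitone_pred_threshold (p : pred nat) (b : nat) :
  (forall c c', (c < c' < b)%N -> p c' -> p c) ->
  exists2 m, (m <= b)%N & forall c, (c < b)%N -> p c = (c < m)%N.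
Proof.
elim: b => [|b IH] h; first by exists 0%N.
have [m lemb hm] : exists2 m, (m <= b)%N & forall c, (c < b)%N -> p c = (c < m)%N.
  by apply: IH => c c' /andP[h1 h2]; apply: h; rewrite h1 ltnS ltnW.
case: (ltnP m b) => [ltmb|lebm].
  exists m => [|c]; first exact: leqW.
  rewrite ltnS leq_eqVlt => /predU1P[->|]; last exact: hm.
  rewrite ltnNge lemb; apply/negbTE/negP => pb.
  have : p m by apply: (h m b) pb; lia.
  by rewrite hm // ltnn.
have e : m = b by apply/eqP; rewrite eqn_leq lemb.
case pb: (p b).
  exists b.+1 => // c; rewrite ltnS leq_eqVlt => /predU1P[->|lt].
    by rewrite pb; lia.
  by rewrite hm // e; lia.
exists b => // c; rewrite ltnS leq_eqVlt => /predU1P[->|lt].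
  by rewrite pb ltnn.
by rewrite hm // e.
Qed.

Lemma increasing_gap (n : nat) (s : 'I_n -> nat) :
  (forall i j : 'I_n, (i < j)%N -> (s i < s j)%N) ->
  forall i j : 'I_n, (i <= j)%N -> (s i + (j - i) <= s j)%N.
Proof.
move=> hs i [j ltj] /=; elim: j ltj => [|j IH] ltj leij.
  by have -> : i = Ordinal ltj by [apply: val_inj => /=; lia]; lia.
move: leij; rewrite leq_eqVlt => /predU1P[e|lt].
  by have -> : i = Ordinal ltj by [apply: val_inj]; rewrite /= subnn addn0.
have := IH (ltnW ltj) lt; have /= := hs (Ordinal (ltnW ltj)) (Ordinal ltj) (ltnSn _).
lia.
Qed.

(** This makes the truncated subtraction in [shape_of_nat] exact. *)
Lemma increasing_ge_id (n : nat) (s : 'I_n -> nat) :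
  (forall i j : 'I_n, (i < j)%N -> (s i < s j)%N) ->
  forall i : 'I_n, (i <= s i)%N.
Proof.
case: n s => [|n] s hs i; first by case: i.
by have := increasing_gap hs (leq0n i : (@ord0 n <= i)%N) => /=; lia.
Qed.

Lemma shape_of_nat_antitone (n : nat) (s : 'I_n -> nat) :
  (forall i j : 'I_n, (i < j)%N -> (s i < s j)%N) ->
  forall i j : 'I_n, (i <= j)%N -> (shape_of_nat s j <= shape_of_nat s i)%N.
Proof.
move=> hs i j leij; rewrite /shape_of_nat.
have le : (rev_ord j <= rev_ord i)%N by rewrite /=; lia.
by have := increasing_gap hs le; have := increasing_ge_id hs (rev_ord j); lia.
Qed.

(** The chain is [t i < s (i + 1) <= s j <= t j]. It allows the induction hypothesis to be applied
    to [t]. *)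
Lemma interlaced_increasing (n B : nat) (s : 'I_n.+1 -> nat)
    (t : {ffun 'I_n -> 'I_B}) :
  (forall i j : 'I_n.+1, (i < j)%N -> (s i < s j)%N) -> interlaced s t ->
  forall i j : 'I_n, (i < j)%N -> (t i < t j)%N.
Proof.
move=> hs /forallP ht i j ltij.
have /andP[_ h1] := ht i; have /andP[h2 _] := ht j.
apply: leq_trans h1 (leq_trans _ h2).
case: (ltnP (lift ord0 i) (widen_ord (leqnSn n) j)) => h; first exact: ltnW (hs _ _ h).
suff -> : lift ord0 i = widen_ord (leqnSn n) j by [].
by apply: val_inj; move: h; rewrite /= /bump /=; lia.
Qed.

Lemma rev_lift_max (n : nat) (j : 'I_n) :
  rev_ord (lift ord_max j) = lift ord0 (rev_ord j).
Proof. by apply: val_inj; rewrite /= /bump /=; have := ltn_ord j; lia. Qed.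

Lemma rev_lift0 (n : nat) (j : 'I_n) :
  rev_ord (lift ord0 j) = widen_ord (leqnSn n) (rev_ord j).
Proof. by apply: val_inj; rewrite /= /bump /=; have := ltn_ord j; lia. Qed.

(** * The branching rule for Schur polynomials *)

Section SchurBranching.
Variables (n B : nat) (s : 'I_n.+1 -> nat).
Hypothesis s_incr : forall i j : 'I_n.+1, (i < j)%N -> (s i < s j)%N.
Hypothesis s_le : forall i, (s i <= B)%N.

Let lam := shape_of_nat s.

(** Reversing the order and subtracting the staircase turns interlacing into the strip condition;
    the strict bound [t i < s (i + 1)] becomes weak because the staircase grows by one. *)
Lemma interlaced_strip (t : {ffun 'I_n -> 'I_B}) :
  interlaced s t ->
  forall j : 'I_n, (lam (lift ord0 j) <= shape_of_nat (fun i => t i) j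
                      <= lam (lift ord_max j))%N.
Proof.
move=> /forallP ht j; rewrite /lam /shape_of_nat rev_lift_max rev_lift0.
have := ht (rev_ord j); have := increasing_ge_id s_incr (widen_ord (leqnSn n) (rev_ord j)).
have -> : (lift ord0 (rev_ord j) : nat) = (rev_ord j).+1 by [].
have -> : (widen_ord (leqnSn n) (rev_ord j) : nat) = rev_ord j by [].
lia.
Qed.

Lemma splits_at_exists (T : filling lam) : semistandard T ->
  exists2 t : {ffun 'I_n -> 'I_B}, interlaced s t &
    splits_at (shape_of_nat (fun i => t i)) T.
Proof.
move=> ss; have /semistandardP[hr hc] := ss.
have /fin_all_exists2[nu nu1 nu2] (j : 'I_n) : exists2 m,
    (m <= lam (lift ord_max j))%N &
    forall c, (c < lam (lift ord_max j))%N ->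
       (box_value T (lift ord_max j) c < n)%N = (c < m)%N.
  apply: (antitone_pred_threshold (p := fun c => (box_value T (lift ord_max j) c < n)%N)).
  by move=> c c' h; apply: leq_ltn_trans; apply: hr.
(* Otherwise column [nu j] would have the letter [n] in row [j] and a box below it, which would need
   a larger letter. *)
have nu3 j : (lam (lift ord0 j) <= nu j)%N.
  rewrite leqNgt; apply/negP => lt.
  have le : (lam (lift ord0 j) <= lam (lift ord_max j))%N.
    by apply: shape_of_nat_antitone => //; rewrite lift_max /= /bump; lia.
  have lt' := leq_trans lt le.
  have := nu2 j _ lt'; rewrite ltnn => /negbT; rewrite -leqNgt => h.
  have lt0 : (lift ord_max j < lift ord0 j)%N by rewrite lift_max /= /bump; lia.
  by have := hc _ _ _ lt0 lt' lt; have := box_value_lt T lt; lia.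
(* The upper strip bound gives [nu (rev_ord i) + i < s (i + 1) <= B], so adding the staircase back
   to [nu] stays within ['I_B]. *)
have bound i : (nu (rev_ord i) + i < B)%N.
  have := nu1 (rev_ord i); rewrite /lam /shape_of_nat rev_lift_max rev_ordK.
  have := increasing_ge_id s_incr (lift ord0 i); have := s_le (lift ord0 i).
  have -> : (lift ord0 i : nat) = i.+1 by [].
  lia.
pose t : {ffun 'I_n -> 'I_B} := [ffun i => Ordinal (bound i)].
have te j : shape_of_nat (fun i => t i) j = nu j.
  by rewrite /shape_of_nat ffunE -[X in (X - _)%N]/(nu _ + _)%N rev_ordK addnK.
exists t.
  apply/forallP => i; rewrite ffunE /=.
  have := nu1 (rev_ord i); have := nu3 (rev_ord i).
  rewrite /lam /shape_of_nat rev_lift_max rev_lift0 rev_ordK.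
  have := increasing_ge_id s_incr (lift ord0 i).
  have := increasing_ge_id s_incr (widen_ord (leqnSn n) i).
  have -> : (lift ord0 i : nat) = i.+1 by [].
  have -> : (widen_ord (leqnSn n) i : nat) = i by [].
  lia.
by apply/splits_atP => j c h; rewrite te nu2.
Qed.

Lemma splits_at_unique (T : filling lam) (t t' : {ffun 'I_n -> 'I_B}) :
  interlaced s t -> interlaced s t' ->
  splits_at (shape_of_nat (fun i => t i)) T ->
  splits_at (shape_of_nat (fun i => t' i)) T -> t = t'.
Proof.
have aux (u u' : {ffun 'I_n -> 'I_B}) j : interlaced s u' ->
  splits_at (shape_of_nat (fun i => u i)) T ->
  splits_at (shape_of_nat (fun i => u' i)) T ->
  (shape_of_nat (fun i => u' i) j <= shape_of_nat (fun i => u i) j)%N.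
  move=> /interlaced_strip/(_ j)/andP[_ le'] /splits_atP h /splits_atP h'.
  (* If the lengths in row [j] differed, the box just past the shorter one would have a letter both
     below [n] and not below [n]. *)
  rewrite leqNgt; apply/negP => lt; have lt2 := leq_trans lt le'.
  by have := h _ _ lt2; rewrite h' // lt ltnn.
move=> it it' st st'; apply/ffunP => i; apply: val_inj => /=.
have := aux t t' (rev_ord i) it' st st'; have := aux t' t (rev_ord i) it st' st.
rewrite /shape_of_nat rev_ordK.
have := increasing_ge_id (interlaced_increasing s_incr it) i.
have := increasing_ge_id (interlaced_increasing s_incr it') i.
lia.
Qed.

(** Each tableau splits at exactly one interlacing [t], so the sum breaks into the fibers of
    [schur_fiber]. The exponents are rewritten in terms of [s] to match [alternant_branching]. *)
Lemma schur_branching (R : comPzRingType) (x : nat -> R) :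
  schur lam x =
  \sum_(t : {ffun 'I_n -> 'I_B} | interlaced s t)
     (x n ^+ s ord0 * \prod_(i < n) x n ^+ (s (lift ord0 i) - (t i).+1))
     * schur (shape_of_nat (fun i => t i)) x.
Proof.
transitivity (\sum_(T : filling lam | semistandard T)
  \sum_(t : {ffun 'I_n -> 'I_B} | interlaced s t)
    if splits_at (shape_of_nat (fun i => t i)) T
    then \prod_(b : box lam) x (T b) else 0).
  apply: eq_bigr => T ss; have [t it st] := splits_at_exists ss.
  rewrite -big_mkcondr (big_pred1 t) // => t' /=.
  apply/andP/eqP => [[it' st']|-> //]; exact: splits_at_unique st' st.
rewrite exchange_big /=; apply: eq_bigr => t it.
rewrite -big_mkcondr schur_fiber; last 2 first.
- exact: shape_of_nat_antitone.
- exact: interlaced_strip.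
congr (_ * _ * _).
  rewrite /lam /shape_of_nat; have -> : rev_ord (@ord_max n) = ord0.
    by apply: val_inj; rewrite /= subnn.
  by rewrite subn0.
rewrite [RHS](reindex_inj rev_ord_inj) /=; apply: eq_bigr => j _.
congr (_ ^+ _); rewrite /lam /shape_of_nat rev_lift_max.
have := increasing_ge_id (interlaced_increasing s_incr it) (rev_ord j).
have -> : (lift ord0 (rev_ord j) : nat) = (rev_ord j).+1 by [].
lia.
Qed.

End SchurBranching.

(** * The bialternant identity *)

Lemma bialternant (R : comPzRingType) (n : nat) (s : 'I_n -> nat)
    (x : nat -> R) :
  (forall i j : 'I_n, (i < j)%N -> (s i < s j)%N) ->
  schur (shape_of_nat s) x * alternant (fun i : 'I_n => i : nat) x =
  alternant s x.
Proof.
elim: n s => [|n IH] s hs.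
  rewrite /alternant !det_mx00 mulr1 /schur.
  have T0 : filling (shape_of_nat s) by apply: finfun => -[[]].
  rewrite (big_pred1 T0) => [|T].
    by rewrite big1 // => -[[]].
  by have -> : T = T0 by [apply/ffunP => -[[]]]; rewrite /= eqxx; apply/forallP => -[[]].
(* Both branching rules must be used with the same [B] for their sums to match term by term. *)
have hB i : (s i <= \max_i s i)%N by exact: leq_bigmax.
rewrite (schur_branching hs hB) (alternant_branching _ hs hB) alternant_id_branching.
rewrite mulrCA; congr (_ * _); rewrite mulr_suml; apply: eq_bigr => t it.
by rewrite -(IH _ (interlaced_increasing hs it)) mulrA.
Qed.

(** * Contents of tableaux *)

Definition content (n : nat) (lam : 'I_n -> nat) (T : filling lam) (i : 'I_n) :
    nat :=
  #|[set b : box lam | T b == i]|.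

Lemma has_weightE (n : nat) (lam mu : 'I_n -> nat) (T : filling lam) :
  has_weight mu T = [forall i, content T i == mu i].
Proof. by []. Qed.

Lemma sum_content (n : nat) (lam : 'I_n -> nat) (T : filling lam) :
  (\sum_(i < n) content T i)%N = weight lam.
Proof.
rewrite /weight; transitivity #|{: box lam}|; last first.
  rewrite -sum1_card.
  rewrite -(@sig_big_dep _ _ _ _ (fun j : 'I_n => 'I_(lam j)) xpredT (fun _ => xpredT)
    (fun j c => 1%N)) /=.
  by apply: eq_bigr => i _; rewrite sum1_card card_ord.
rewrite -sum1_card (partition_big (fun b => T b) xpredT) //=.
by apply: eq_bigr => i _; rewrite sum1dep_card /content.
Qed.

(** * Symmetry of Kostka numbers and substitution into monomials *)

Section Polynomials.
Variables (K : idomainType) (n : nat).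

(** Formal variables as a sequence on [nat], the form taken by [schur] and [alternant]; the value 0
    beyond [n] is never read there. *)
Definition permuted_var (sg : 'S_n) (j : nat) : {mpoly K[n]} :=
  if insub j is Some i then 'X_(sg i) else 0.

Lemma permuted_varE (sg : 'S_n) (i : 'I_n) : permuted_var sg i = 'X_(sg i).
Proof. by rewrite /permuted_var valK. Qed.

(** A letter [l] contributes the variable of index [sg l], so the exponent at [i] counts the letter
    [sg^-1 i]. *)
Lemma prod_permuted_var (lam : 'I_n -> nat) (T : filling lam) (sg : 'S_n) :
  \prod_(b : box lam) permuted_var sg (T b) =
  'X_[[multinom content T ((sg^-1)%g i) | i < n]].
Proof.
under eq_bigr => b _ do rewrite permuted_varE.
rewrite mprodXE; congr mpolyX; apply/mnmP => i; rewrite mnm_sumE mnmE.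
rewrite /content -sum1dep_card [RHS]big_mkcond /=; apply: eq_bigr => b _.
rewrite mnm1E -(inj_eq (@perm_inj _ (sg^-1)%g)) permK.
by case: eqP.
Qed.

Lemma alternant_permuted (s : 'I_n -> nat) (sg : 'S_n) :
  alternant s (permuted_var sg) = (-1) ^+ sg * alternant s (permuted_var 1).
Proof.
rewrite /alternant.
have -> : \matrix_(i < n, j < n) permuted_var sg j ^+ s i =
  col_perm sg (\matrix_(i < n, j < n) permuted_var 1 j ^+ s i).
  by apply/matrixP => i j; rewrite !mxE !permuted_varE perm1.
by rewrite col_permE det_mulmx det_perm odd_permV mulrC.
Qed.

Lemma alternant_var (s : 'I_n -> nat) :
  alternant s (permuted_var 1) =
  \sum_(sg : 'S_n) (-1) ^+ sg *: 'X_[[multinom s ((sg^-1)%g j) | j < n]].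
Proof.
apply: eq_bigr => sg _.
have -> : (-1) ^+ sg = ((-1) ^+ sg)%:MP :> {mpoly K[n]}.
  by case: (sg : bool); rewrite ?expr0 ?expr1 ?mpolyCN ?mpolyC1.
rewrite mul_mpolyC; congr (_ *: _); rewrite (mpolyXE _ sg).
by apply: eq_bigr => i _; rewrite !mxE permuted_varE perm1 mnmE permK.
Qed.

(** The monomial with exponents 0, ..., n - 1 comes only from the identity permutation, with
    coefficient 1. *)
Lemma alternant_id_neq0 :
  alternant (fun i : 'I_n => i : nat) (permuted_var 1) != 0.
Proof.
apply/eqP => /(congr1 (mcoeff [multinom (j : nat) | j < n])).
rewrite alternant_var mcoeff0 raddf_sum /= (bigD1 (1%g : 'S_n)) //= big1 ?addr0 => [|sg nsg].
  rewrite mcoeffZ mcoeffX odd_perm1 expr0 mul1r.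
  rewrite (_ : _ == _) ?[_%:R]/(1 : K); first by move/eqP; rewrite oner_eq0.
  by apply/eqP/mnmP => j; rewrite !mnmE invg1 perm1.
rewrite mcoeffZ mcoeffX (_ : _ == _ = false) ?mulr0 //.
apply/negP => /eqP/mnmP h; move/eqP: nsg; apply; apply/permP => i; rewrite perm1.
by have := h (sg i); rewrite !mnmE permK => /val_inj.
Qed.

Variable s : 'I_n -> nat.
Hypothesis s_incr : forall i j : 'I_n, (i < j)%N -> (s i < s j)%N.
Let lam := shape_of_nat s.

(* The bialternant quotient is manifestly invariant under permuting the
   variables, so the Vandermonde factor is cancelled. *)
Lemma schur_symmetric (sg : 'S_n) :
  schur lam (permuted_var sg) = schur lam (permuted_var 1).
Proof.
have eq1 := bialternant (permuted_var 1) s_incr.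
have eqs := bialternant (permuted_var sg) s_incr.
rewrite !(alternant_permuted _ sg) -eq1 in eqs.
apply: (mulIf alternant_id_neq0); move: eqs; rewrite /lam.
set u := schur _ (permuted_var sg); set v := schur _ (permuted_var 1).
set w := alternant _ _.
rewrite mulrCA => /(congr1 (fun z => (-1) ^+ sg * z)).
by rewrite !signrMK.
Qed.

Lemma mcoeff_schur (sg : 'S_n) (m : 'X_{1..n}) :
  (schur lam (permuted_var sg))@_m = (Kostka lam (fun i => m (sg i)))%:R.
Proof.
rewrite /schur raddf_sum /= /Kostka -sum1dep_card natr_sum /=.
rewrite [RHS](eq_bigl (fun T => semistandard T && has_weight (fun i => m (sg i)) T)) //.
rewrite [RHS]big_mkcondr /=; apply: eq_bigr => T _.
rewrite prod_permuted_var mcoeffX has_weightE.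
rewrite (_ : (_ == m) = [forall i, content T i == m (sg i)]); first by case: ifP.
apply/eqP/forallP => [<- i|h]; first by rewrite mnmE permK.
by apply/mnmP => i; rewrite mnmE (eqP (h _)) permKV.
Qed.

(** Both sides are the coefficient of the monomial with exponents [mu], before and after permuting
    the variables; the equality is thus obtained in [K]. *)
Lemma Kostka_permuted (mu : 'I_n -> nat) (sg : 'S_n) :
  (Kostka lam (fun i => mu (sg i)))%:R = (Kostka lam mu)%:R :> K.
Proof.
have := congr1 (mcoeff [multinom mu i | i < n]) (schur_symmetric sg).
have eK f g : f =1 g -> Kostka lam f = Kostka lam g.
  move=> e; apply: eq_card => T; rewrite !inE; congr andb.
  by apply: eq_forallb => i; rewrite e.
rewrite !mcoeff_schur (eK _ (fun i => mu (sg i))) => [->|i]; last by rewrite mnmE.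
by rewrite (eK _ mu) // => i; rewrite mnmE perm1.
Qed.

(** Monomials are linearly independent, so any [phi] on exponents extends to a linear form. Both
    sides are rewritten as that form applied to the common polynomial. *)
Lemma monomial_substitution (I J : finType) (c : I -> K) (d : J -> K)
    (m : I -> 'X_{1..n}) (m' : J -> 'X_{1..n}) (phi : 'X_{1..n} -> K) :
  \sum_i c i *: 'X_[m i] = \sum_j d j *: 'X_[m' j] ->
  \sum_i c i * phi (m i) = \sum_j d j * phi (m' j).
Proof.
(* A strict bound on all degrees on both sides, so that one finite set of monomials suffices. *)
move=> e; pose k := (\max_i mdeg (m i) + \max_j mdeg (m' j)).+1.
have expand (H : finType) (b : H -> K) (q : H -> 'X_{1..n}) :
    (forall h, (mdeg (q h) < k)%N) ->
    \sum_h b h * phi (q h) =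
    \sum_(u : 'X_{1..n < k}) (\sum_h b h *: 'X_[q h])@_u * phi u.
  move=> hk.
  under [RHS]eq_bigr => u _ do rewrite raddf_sum mulr_suml.
  rewrite exchange_big /=; apply: eq_bigr => h _.
  rewrite (bigD1 (BMultinom (hk h))) //= big1 ?addr0 => [|u nu].
    by rewrite mcoeffZ mcoeffX eqxx mulr1.
  rewrite mcoeffZ mcoeffX (_ : _ == _ = false) ?mulr0 ?mul0r //.
  by apply/negP => /eqP eq; case/eqP: nu; apply: val_inj; rewrite /= eq.
rewrite (expand _ c) => [|i]; last first.
  by rewrite ltnS (leq_trans (leq_bigmax (F := fun i => mdeg (m i)) i)) // leq_addr.
rewrite (expand _ d) ?e // => j.
by rewrite ltnS (leq_trans (leq_bigmax (F := fun j => mdeg (m' j)) j)) // leq_addl.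
Qed.

Lemma det_sum_tableaux (a : nat -> 'I_n -> K) :
  \det (\matrix_(i < n, j < n) a (s i) j) =
  \sum_(T : filling lam | semistandard T)
    \det (\matrix_(i < n, j < n) a (content T j + i)%N j).
Proof.
pose phi (m : 'X_{1..n}) := \prod_(j < n) a (m j) j.
pose rho (sg : 'S_n) := [multinom (((sg^-1)%g j : 'I_n) : nat) | j < n].
pose wt (T : filling lam) := [multinom content T i | i < n].
have := bialternant (permuted_var 1) s_incr; rewrite !alternant_var.
(* Since [monomial_substitution] sums over a whole finite type, fillings that are not semistandard
   are kept with coefficient 0. *)
have -> : schur lam (permuted_var 1) * \sum_(sg : 'S_n) (-1) ^+ sg *: 'X_[rho sg] =
  \sum_(p : filling lam * 'S_n)
    ((semistandard p.1)%:R * (-1) ^+ p.2) *: 'X_[(wt p.1 + rho p.2)%MM].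
  rewrite -(pair_bigA _ (fun T sg => ((semistandard T)%:R * (-1) ^+ (sg : 'S_n)) *: 'X_[(wt T + rho sg)%MM])) /=.
  rewrite /schur mulr_suml [LHS]big_mkcond /=; apply: eq_bigr => T _.
  case: ifP => _; last by rewrite big1 // => sg _; rewrite mul0r scale0r.
  rewrite mulr_sumr; apply: eq_bigr => sg _.
  rewrite mul1r prod_permuted_var -scalerAr mpolyXD; congr (_ *: ('X_[_] * _)).
  by apply/mnmP => i; rewrite !mnmE invg1 perm1.
move/(monomial_substitution phi) => /esym e.
transitivity (\sum_(sg : 'S_n) (-1) ^+ sg * phi [multinom s ((sg^-1)%g j) | j < n]).
  apply: eq_bigr => sg _; congr (_ * _); rewrite [RHS](reindex_inj (@perm_inj _ sg)) /=.
  by apply: eq_bigr => i _; rewrite mxE mnmE permK.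
rewrite e -(pair_bigA _ (fun T sg => ((semistandard T)%:R * (-1) ^+ (sg : 'S_n)) * phi (wt T + rho sg)%MM)) /=.
rewrite [RHS]big_mkcond /=; apply: eq_bigr => T _.
case: ifP => _; last by rewrite big1 // => sg _; rewrite !mul0r.
apply: eq_bigr => sg _; rewrite mul1r; congr (_ * _).
rewrite [LHS](reindex_inj (@perm_inj _ sg)) /=.
by apply: eq_bigr => i _; rewrite mxE mnmDE !mnmE permK.
Qed.

End Polynomials.

(** * Decreasing rearrangements *)

Section Rearrangements.
Variables (n k : nat).
Implicit Types (p mu : {ffun 'I_n -> 'I_k}).

Lemma weight_rearrangement p mu :
  p \in rearrangements mu -> weight (fun i => p i) = weight (fun i => mu i).
Proof.
case/imsetP => sg _ ->; rewrite /weight [RHS](reindex_inj (@perm_inj _ sg)).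
by apply: eq_bigr => i _; rewrite ffunE.
Qed.

Lemma decreasing_rearrangement_exists p :
  exists2 mu : {ffun 'I_n -> 'I_k}, weakly_decreasing (fun i => mu i) & p \in rearrangements mu.
Proof.
pose r := relpre (nat_of_ord (n := k)) geq.
pose tp := [tuple p i | i < n].
have /tuple_permP[sg esg] : perm_eq (sort_tuple r tp) tp by rewrite perm_sort.
exists [ffun i => tnth (sort_tuple r tp) i].
  have srt : sorted r (sort_tuple r tp).
    by apply: sort_sorted => a b; rewrite /r /=; lia.
  apply/forallP => i; apply/forallP => j; apply/implyP => leij; rewrite !ffunE.
  have k0 : 'I_k := p i.
  rewrite !(tnth_nth k0).
  apply: (sorted_leq_nth _ _ k0 srt) => //; rewrite ?inE ?size_tuple ?ltn_ord //.
  - by move=> a b c; rewrite /r /=; lia.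
  - by move=> a; rewrite /r /=; lia.
(* The permutation [sg] sorts [p], while membership asks for the way back from the sorted tuple to
   [p]. *)
apply/imsetP; exists (sg^-1)%g => //; apply/ffunP => i; rewrite !ffunE.
rewrite (_ : sort_tuple r tp = [tuple tnth tp (sg i) | i < n]); last exact: val_inj.
by rewrite !tnth_mktuple permKV.
Qed.

(** Two sorted lists that are permutations of each other coincide, the order being antisymmetric. *)
Lemma decreasing_rearrangement_unique p mu mu' :
  weakly_decreasing (fun i => mu i) -> weakly_decreasing (fun i => mu' i) ->
  p \in rearrangements mu -> p \in rearrangements mu' -> mu = mu'.
Proof.
pose r := relpre (nat_of_ord (n := k)) geq.
pose tup (u : {ffun 'I_n -> 'I_k}) := [tuple u i | i < n].
have srt (u : {ffun 'I_n -> 'I_k}) : weakly_decreasing (fun i => u i) -> sorted r (tup u).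
  move=> /forallP dec; rewrite /tup /= sorted_map.
  apply: (@sub_sorted _ (relpre (nat_of_ord (n := n)) leq)) => [i j|].
    by move=> leij; have /forallP/(_ j)/implyP := dec i; apply.
  by rewrite -sorted_map val_enum_ord iota_sorted.
have prm u : p \in rearrangements u -> perm_eq (tup p) (tup u).
  case/imsetP => sg _ ->; apply/tuple_permP; exists sg.
  by apply: congr1; apply: eq_from_tnth => i; rewrite !tnth_mktuple ffunE.
move=> d d' h h'; have e : tup mu = tup mu'.
  apply: val_inj; apply: (@sorted_eq _ r) (srt _ d) (srt _ d') _.
  - by move=> a b c; rewrite /r /=; lia.
  - by move=> a b; rewrite /r /= => ?; apply: val_inj => /=; lia.
  by rewrite -(permPl (prm _ h)) prm.
by apply/ffunP => i; rewrite -(tnth_mktuple mu) -/(tup mu) e tnth_mktuple.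
Qed.

End Rearrangements.

(** * Grouping tableaux by content *)

(** The parts of a content sum to [weight lam], so each is at most that, and every tableau matches
    exactly one [p]. Extensionality of [F] is assumed because [p] agrees with the content only
    pointwise. *)
Lemma sum_tableaux_by_content (R : comPzRingType) (n : nat) (lam : 'I_n -> nat)
    (F : ('I_n -> nat) -> R) :
  (forall f g, f =1 g -> F f = F g) ->
  \sum_(T : filling lam | semistandard T) F (content T) =
  \sum_(p : {ffun 'I_n -> 'I_(weight lam).+1}
        | weight (fun i => p i) == weight lam)
    (Kostka lam (fun i => p i))%:R * F (fun i => p i).
Proof.
move=> extF.
transitivity (\sum_(T : filling lam | semistandard T)
  \sum_(p : {ffun 'I_n -> 'I_(weight lam).+1}
        | weight (fun i => p i) == weight lam)
    if has_weight (fun i => p i) T then F (fun i => p i) else 0).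
  apply: eq_bigr => T _.
  have lt i : (content T i < (weight lam).+1)%N.
    by rewrite ltnS -(sum_content T) (bigD1 i) //= leq_addr.
  rewrite -big_mkcondr (big_pred1 [ffun i => Ordinal (lt i)]) /=.
    by apply: extF => i; rewrite ffunE.
  move=> p; rewrite has_weightE; apply/andP/eqP => [[_ /forallP h]|->].
    by apply/ffunP => i; apply: val_inj; rewrite ffunE /= (eqP (h i)).
  split; last by apply/forallP => i; rewrite ffunE.
  by apply/eqP; rewrite -[RHS](sum_content T); apply: eq_bigr => i _; rewrite ffunE.
rewrite exchange_big /=; apply: eq_bigr => p _.
rewrite -big_mkcondr sumr_const -[LHS]mulr_natl; congr (_%:R * _).
by apply: eq_card => T; rewrite !inE.
Qed.

Theorem theorem1 (R : realType) (M n : nat) (hMn : (n <= M)%N)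
    (A : 'M[R[i]]_(M, n)) (s : 'I_n -> 'I_M)
    (hs : forall i j : 'I_n, (i < j)%N -> (s i < s j)%N) :
  \det (rowsub s A) =
    \sum_(mu in decreasing_tuples (shape_of s))
      (Kostka (shape_of s) (fun i => mu i))%:R * Dsum A mu.
Proof.
pose D (p : 'I_n -> nat) := \det (\matrix_(i < n, j < n) entry A (p j + i)%N j).
have -> : rowsub s A = \matrix_(i < n, j < n) entry A (s i) j.
  by apply/matrixP => i j; rewrite !mxE /entry valK.
rewrite (det_sum_tableaux hs) (@sum_tableaux_by_content _ _ _ D); last first.
  by move=> f g e; congr (\det _); apply/matrixP => i j; rewrite !mxE e.
rewrite -/(shape_of s).
(* Each [p] of the right weight rearranges exactly one decreasing [mu], so inserting the sum over
   [mu] changes nothing. Within a class, symmetry replaces the Kostka number of [p] by that of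
   [mu]. *)
transitivity (\sum_(mu in decreasing_tuples (shape_of s))
  \sum_(p : {ffun 'I_n -> 'I_(weight (shape_of s)).+1}
         | weight (fun i => p i) == weight (shape_of s))
    if p \in rearrangements mu
    then (Kostka (shape_of s) (fun i => p i))%:R * D (fun i => p i) else 0).
  rewrite exchange_big /=; apply: eq_bigr => p wp.
  have [mu dmu pmu] := decreasing_rearrangement_exists p.
  rewrite -big_mkcondr (big_pred1 mu) // => mu' /=; rewrite inE.
  apply/andP/eqP => [[/andP[d _] h]|->]; first exact: decreasing_rearrangement_unique h pmu.
  by rewrite dmu pmu -(weight_rearrangement pmu).
apply: eq_bigr => mu; rewrite inE => /andP[_ wmu].
rewrite /Dsum mulr_sumr -big_mkcondr; apply: eq_big => [p|p /andP[_ /imsetP[sg _ ->]]].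
  by apply: andb_idl => /weight_rearrangement ->.
congr (_ * _); rewrite -[RHS](Kostka_permuted _ hs _ sg) -/(shape_of s).
congr (_%:R); apply: eq_card => T; rewrite !inE; congr andb.
by apply: eq_forallb => i; rewrite ffunE.
Qed.
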